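(* For every signed graph $(G,\sigma)$ and every positive integer $k$, $$\chi\big(\hat{G}^{[-k]}\big)\le \Big((\mathrm{wcol}_k(G)+1)\cdot(\lfloor k/2\rfloor+2)\cdot 3\Big)^{q},\qquad\text{where } q=\mathrm{wcol}_{\lfloor k/2\rfloor}(G).$$
   Context: A signed graph $(G,\sigma)$ is a finite simple graph $G$ with $\sigma:E(G)\to\{+,-\}$; the sign of a path is the product of its edge signs. For a positive integer $k$, $\hat{G}^{[-k]}$ is the graph on $V(G)$ in which $xy$ is an edge iff $d_G(x,y)=k$ and every $xy$-path of length $k$ is negative. For a total ordering $L$ of $V(G)$ and $y\in V(G)$, a vertex $x$ is weakly $r$-reachable from $y$ if there is an $xy$-path $P$ of length at most $r$ with $x\le_L z$ for all vertices $z$ of $P$; $\mathrm{WReach}_r[G,L,y]$ is the set of such $x$ (including $y$). $\mathrm{wcol}_r(G)=\min_L\max_{v}|\mathrm{WReach}_r[G,L,v]|$. *)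

(* Defs.v *)
From mathcomp Require Import all_boot.

Set Implicit Arguments.
Unset Strict Implicit.
Unset Printing Implicit Defensive.

Record sgraph := SGraph {
  vertex :> finType;
  edge : rel vertex;
  edge_sym : symmetric edge;
  edge_irr : irreflexive edge
}.

Section Paths.
Variable G : sgraph.
Implicit Types (x y : G) (p : seq G).

(* The vertices of the path are those of x :: p, so its length is size p. *)
Definition is_path x y p :=
  [&& path (@edge G) x p, last x p == y & uniq (x :: p)].

Definition has_path n x y := [exists p : n.-tuple G, is_path x y p].

(* d_G(x, y) = n; never true when x and y are in different components. *)
Definition dist_is n x y := has_path n x y && [forall m : 'I_n, ~~ has_path m x y].

(* Signs form the group (bool, addb) with true for -. A signature is read only
   at the sets [set x; y] with edge x y; its other values are irrelevant. *)
Definition signature := {set G} -> bool.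

Definition path_neg (sigma : signature) x p : bool :=
  \big[addb/false]_(s <- pairmap (fun u v => sigma [set u; v]) x p) s.

Definition hat_edge (sigma : signature) k : rel G := fun x y =>
  dist_is k x y && [forall p : k.-tuple G, is_path x y p ==> path_neg sigma x p].

Lemma is_path_rev x y p :
  is_path x y p -> is_path y x (rev (belast x p)).
Proof.
case/and3P=> xp /eqP <- Up; apply/and3P; split.
- by rewrite rev_path (eq_path (e' := @edge G)) // => u v; rewrite edge_sym.
- by case: p {xp Up} => //= a p; rewrite rev_cons last_rcons.
- by rewrite -rev_rcons -lastI rev_uniq.
Qed.

Lemma path_neg_rev sigma x p :
  path_neg sigma (last x p) (rev (belast x p)) = path_neg sigma x p.
Proof.
rewrite /path_neg; elim: p x => //= a p IH x.
have cat_neg u s b : \big[addb/false]_(i <- pairmap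
    (fun u v : G => sigma [set u; v]) u (rcons s b)) i
  = (\big[addb/false]_(i <- pairmap (fun u v : G => sigma [set u; v]) u s) i)
    (+) sigma [set last u s; b].
  by rewrite -cats1 pairmap_cat big_cat /= big_seq1.
have Ela : last (last a p) (rev (belast a p)) = a.
  by case: p {IH} => //= b p; rewrite rev_cons last_rcons.
by rewrite rev_cons cat_neg IH Ela big_cons addbC setUC.
Qed.

Lemma has_path_sym n : symmetric (has_path n).
Proof.
suff H x y : has_path n x y -> has_path n y x by move=> x y; apply/idP/idP; exact: H.
case/existsP=> p /is_path_rev Pp; apply/existsP.
have sz : size (rev (belast x p)) == n by rewrite size_rev size_belast size_tuple.
by exists (Tuple sz).
Qed.

Lemma hat_edge_sym sigma k : symmetric (hat_edge sigma k).
Proof.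
suff H x y : hat_edge sigma k x y -> hat_edge sigma k y x.
  by move=> x y; apply/idP/idP; exact: H.
case/andP=> /andP[xy /forallP near] /forallP neg; apply/andP; split.
  rewrite /dist_is has_path_sym xy; apply/forallP=> m.
  by rewrite has_path_sym near.
apply/forallP=> p; apply/implyP=> Pp.
have sz : size (rev (belast y p)) == k by rewrite size_rev size_belast size_tuple.
have /implyP/(_ (is_path_rev Pp)) := neg (Tuple sz).
by case/and3P: Pp => _ /eqP <- _ /=; rewrite path_neg_rev.
Qed.

Lemma hat_edge_irr sigma k : irreflexive (hat_edge sigma k).
Proof.
move=> x; apply/negbTE/negP=> /andP[/andP[_ /forallP near] /forallP neg].
have Px : is_path x x [::] by rewrite /is_path /= eqxx.
case: k near neg => [|k] near neg.
  by have := neg [tuple]; rewrite Px /path_neg /= big_nil.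
by have /existsP[] := near ord0; exists [tuple].
Qed.

Definition hat_graph (sigma : signature) k : sgraph :=
  SGraph (hat_edge_sym sigma k) (hat_edge_irr sigma k).

End Paths.

Section Chromatic.
Variable G : sgraph.

Definition colorable n :=
  [exists f : {ffun G -> 'I_n}, [forall x, forall y, edge x y ==> (f x != f y)]].

Lemma colorable_ex : exists n, colorable n.
Proof.
exists #|G|; apply/existsP; exists [ffun x => enum_rank x].
apply/forallP=> x; apply/forallP=> y; apply/implyP; rewrite !ffunE.
by apply: contraTneq => /enum_rank_inj ->; rewrite edge_irr.
Qed.

Definition chi := ex_minn colorable_ex.

End Chromatic.

Section WeakColoring.
Variable G : sgraph.

(* An ordering is the set L of the pairs (x, y) such that x <=_L y. *)
Definition total_ordering (L : {set G * G}) :=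
  [&& [forall x, (x, x) \in L],
      [forall x, forall y, ((x, y) \in L) && ((y, x) \in L) ==> (x == y)],
      [forall x, forall y, forall z,
         ((x, y) \in L) && ((y, z) \in L) ==> ((x, z) \in L)]
    & [forall x, forall y, ((x, y) \in L) || ((y, x) \in L)]].

Definition WReach r (L : {set G * G}) (y : G) : {set G} :=
  [set x | [exists n : 'I_r.+1, exists p : n.-tuple G,
              is_path x y p && all (fun z => (x, z) \in L) (x :: p)]].

Definition is_wcol_of r n := [exists L : {set G * G},
  total_ordering L && (\max_(v : G) #|WReach r L v| == n)].

Lemma is_wcol_of_ex r : exists n, is_wcol_of r n.
Proof.
pose L := [set xy : G * G | enum_rank xy.1 <= enum_rank xy.2].
exists (\max_(v : G) #|WReach r L v|); apply/existsP; exists L.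
rewrite eqxx andbT; apply/and4P; split.
- by apply/forallP=> x; rewrite inE.
- apply/forallP=> x; apply/forallP=> y; rewrite !inE /=.
  by apply/implyP; rewrite -eqn_leq => /eqP/val_inj/enum_rank_inj ->.
- apply/forallP=> x; apply/forallP=> y; apply/forallP=> z; rewrite !inE /=.
  by apply/implyP=> /andP[]; exact: leq_trans.
- by apply/forallP=> x; apply/forallP=> y; rewrite !inE /= leq_total.
Qed.

Definition wcol r := ex_minn (is_wcol_of_ex r).

End WeakColoring.

(* Main.v *)
Require Import Defs.
From mathcomp Require Import all_boot zify.

Set Implicit Arguments.
Unset Strict Implicit.
Unset Printing Implicit Defensive.

(* Put t = k./2, q = wcol t and N = wcol k.  The two numbers may be attained only
   by different orderings L1 and L2, and this is the whole difficulty.  Let x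
   and y be adjacent in the hat graph, P a geodesic between them, w its
   L2-minimum, say at distance at most t from x, and v the L1-minimum of P
   between x and w.  Then v is one of at most q hubs of x (the vertices weakly
   t-reachable for L1), and one of at most N * q hubs seen by y, through the
   vertices w weakly k-reachable from y for L2.  Let u be a hub of y at the same
   distance from y as v from x.  If u = v then k is even, v is in the middle of
   P, and the signs of the two halves differ.  If u <> v, the L2-minimum of the
   walk of length k from v through y to u shows that one of u, v sees the other.
   The digraph "u sees v" has outdegree at most N * q, so it has a proper
   colouring a with 2 * N * q + 1 colours.

   Hence the set Q y of the pairs (colour, label) of the hubs of y, the label
   encoding distance and sign, is disjoint from the set D y, of size at most
   N * q, of the pairs coming from the hubs v of the neighbours x of y as above,
   while Q x meets D y.  If y gets a set Z with Q y inside Z and D y outside Z,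
   then x and y get different sets.  A random Z containing each pair with
   probability 1 / (N + 1) works for y with probability at least
   1 / (3 ^ q * (N + 1) ^ (q - 1)), where the hub y of y itself is left out; the
   case v = x is dealt with by choosing the sets Z as a proper list colouring of
   "u sees v".  The factor (t + 2) ^ q pays for the union bound over all pairs
   (Q y, D y) when q > 3; for q <= 3 the sets Z = Q y are few enough. *)

(** * List colourings of digraphs of bounded outdegree *)

(** Averaging over the arcs inside [U], some vertex of [U] has at most [m] in-neighbours there;
    coloured last, it has at most [2 * m] colours to avoid. *)
Lemma arc_list_coloring (T C : finType) (arc : rel T) (m : nat)
    (lst : T -> {set C}) :
  irreflexive arc -> (forall u, #|[set v | arc u v]| <= m) ->
  (forall u, 2 * m < #|lst u|) ->
  exists2 f : T -> C, (forall u, f u \in lst u)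
    & (forall u v, arc u v -> f u != f v).
Proof.
move=> arc_irr outdeg big_lst.
suff col (U : {set T}) : exists2 f : T -> C, (forall u, f u \in lst u)
    & {in U &, forall u v, arc u v -> f u != f v}.
  by have [f lstf propf] := col setT; exists f => // u v; apply: propf; rewrite inE.
have [n leUn] := ubnP #|U|; elim: n U leUn => // n IHn U /ltnSE-leUn.
have [->|/set0Pn[u0 Uu0]] := eqVneq U set0.
  have ex_f u : {c | c \in lst u}.
    have /card_gt0P/sigW[c lst_c] := leq_ltn_trans (leq0n _) (big_lst u).
    by exists c.
  by exists (fun u => sval (ex_f u)) => [u | u v]; [exact: (svalP (ex_f u)) | rewrite inE].
have [/exists_inP[u Uu indeg]|] :=
    boolP [exists u in U, #|[set v in U | arc v u]| <= m]; last first.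
  rewrite negb_exists_in => /forall_inP no_low.
  suff: \sum_(u in U) #|[set v in U | arc v u]| <= \sum_(u in U) m.
    rewrite leqNgt => /negP[]; rewrite (bigD1 u0) //= [X in _ < X](bigD1 u0) //=.
    rewrite -addSn leq_add //; first by rewrite ltnNge no_low.
    by apply: leq_sum => u /andP[Uu _]; apply: ltnW; rewrite ltnNge no_low.
  have cardE (P : pred T) : #|[set v in U | P v]| = \sum_(v in U) P v.
    by rewrite -sum1dep_card big_mkcondr; apply: eq_bigr => v _; case: (P v).
  under eq_bigr do rewrite cardE.
  rewrite exchange_big /=; apply: leq_sum => u _; rewrite -cardE.
  apply: leq_trans (outdeg u); apply/subset_leq_card/subsetP=> v.
  by rewrite !inE => /andP[].
have [|f lstf propf] := IHn (U :\ u); first by rewrite (cardsD1 u) Uu in leUn.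
pose B := f @: ([set v in U | arc v u] :|: [set v | arc u v]).
have [c /setDP[lst_c B'c]] : exists c, c \in lst u :\: B.
  apply/card_gt0P; rewrite cardsD subn_gt0.
  apply: leq_ltn_trans (big_lst u); apply: leq_trans (subset_leq_card (subsetIr _ _)) _.
  apply: leq_trans (leq_imset_card _ _) _; rewrite mul2n -addnn.
  by apply: leq_trans (leq_card_setU _ _) _; rewrite leq_add.
exists (fun v => if v == u then c else f v) => [v | v w Uv Uw].
  by case: eqP => [->|].
have [->|u'v] := eqVneq v u; have [->|u'w] := eqVneq w u; rewrite ?arc_irr //.
- move=> uw; apply: contraNneq B'c => ->; apply: imset_f.
  by rewrite !inE uw orbT.
- move=> vu; apply: contraNneq B'c => <-; apply: imset_f.
  by rewrite !inE vu Uv.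
by apply: propf; rewrite !inE ?u'v ?u'w.
Qed.

(** * Random separating families of sets *)

Lemma succ_exp_bound N : N.+1 ^ N <= 3 * N ^ N.
Proof.
case: N => // N0; set N := N0.+1.
(* Divided by [N ^ (j + 2)], this says (1 + 1/N)^j <= 1 + j/N + (j/N)^2, whose right side is 3 at
   [j = N]. *)
suff H j : j <= N -> N.+1 ^ j * N ^ 2 <= N ^ j * (N ^ 2 + j * N + j ^ 2).
  have := H N (leqnn _); rewrite (_ : N ^ 2 + N * N + N ^ 2 = 3 * N ^ 2); last lia.
  by rewrite mulnA [N ^ N * 3]mulnC leq_pmul2r // expn_gt0.
elim: j => [|j IHj] ltjN; first by rewrite !expn0 !mul1n mul0n !addn0.
rewrite 2![_ ^ j.+1]expnSr mulnAC.
apply: leq_trans (leq_mul (IHj (ltnW ltjN)) (leqnn N.+1)) _.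
rewrite -!mulnA leq_mul2l; apply/orP; right.
have -> : (N ^ 2 + j * N + j ^ 2) * N.+1
    = N * (N ^ 2 + j.+1 * N + j * j) + (j * N + j * j) by rewrite -!mulnn; lia.
have -> : N * (N ^ 2 + j.+1 * N + j.+1 ^ 2)
    = N * (N ^ 2 + j.+1 * N + j * j) + (j * N + N * j.+1).
  by rewrite -!mulnn; lia.
by rewrite !leq_add2l leq_mul // ltnW.
Qed.

Lemma double_exp_pred m : 0 < m -> 2 * m ^ m.+1 <= m.+1 ^ m.+1.
Proof.
(* Bernoulli's inequality (1 + 1/m)^j >= 1 + j/m, to be taken at [j = m.+1]. *)
move=> m_gt0; suff H j : m ^ j * (m + j) <= m.+1 ^ j * m.
  rewrite -(leq_pmul2r m_gt0); apply: leq_trans (H m.+1).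
  by rewrite mulnAC mulnC leq_mul2l; apply/orP; right; lia.
elim: j => [|j IHj]; first by rewrite addn0.
rewrite [m.+1 ^ j.+1]expnSr mulnAC; apply: leq_trans (leq_mul IHj (leqnn m.+1)).
by rewrite expnSr -!mulnA leq_mul2l; apply/orP; right; nia.
Qed.

(* Choose the members one at a time, so that the sum over [i] of
   [2 ^ (number of members not good for i)] grows each time by a factor of at
   most [2 - 1 / M]. *)
Lemma multicover (I H : finType) (P : pred I) (good : H -> I -> bool)
    (M E L : nat) :
    0 < M -> 0 < #|H| ->
    (forall i, P i -> #|H| <= M * #|[set h | good h i]|) ->
    #|I| * 2 ^ L <= 2 ^ E ->
  exists Z : 'I_(2 * M * E) -> H,
    forall i, P i -> L <= #|[set c | good (Z c) i]|.
Proof.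
move=> M_gt0 H_gt0 dense large.
pose W s := \sum_(i | P i) 2 ^ count (fun h => ~~ good h i) s.
(* Averaging over [h]: it fails to be good for [i] with probability at most 1 - 1/M, so the mean
   growth factor is at most 2 - 1/M. *)
have step s : exists h, M * W (h :: s) <= (2 * M).-1 * W s.
  apply/existsP; apply: contraT; rewrite negb_exists => /forallP no_h.
  suff: M * (\sum_h W (h :: s)) <= #|H| * ((2 * M).-1 * W s).
    rewrite leqNgt => /negP[]; rewrite -sum_nat_const [X in _ < X]big_distrr /=.
    have [h0 _] := card_gt0P H_gt0.
    rewrite (bigD1 h0) //= [X in _ < X](bigD1 h0) //= -addSn leq_add //.
      by rewrite ltnNge no_h.
    by apply: leq_sum => h _; apply: ltnW; rewrite ltnNge no_h.
  rewrite /W exchange_big mulnA !big_distrr /=; apply: leq_sum => i Pi.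
  under eq_bigr => h _ do rewrite expnD.
  rewrite -big_distrl /= mulnA leq_mul2r; apply/orP; right.
  have -> : \sum_h 2 ^ (~~ good h i) = 2 * #|H| - #|[set h | good h i]|.
    apply/eqP; rewrite eq_sym -(eqn_add2r #|[set h | good h i]|) subnK; last first.
      by apply: leq_trans (max_card _) _; rewrite leq_pmull.
    rewrite -[X in _ + X]sum1dep_card [X in _ + X]big_mkcond -big_split /=.
    rewrite mulnC -sum_nat_const; apply/eqP/eq_bigr => h _.
    by case: (good h i).
  have := dense i Pi; have := max_card [set h | good h i].
  set g := #|[set h | _]|; set c := #|H| => le_gc le_cg.
  by rewrite mulnBr; nia.
have greedy T : exists2 s, size s = T & M ^ T * W s <= (2 * M).-1 ^ T * #|I|.
  elim: T => [|T [s <- IHs]].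
    exists [::] => //; rewrite !mul1n /W sum1_card.
    exact: max_card.
  have [h Hh] := step s; exists (h :: s) => //=.
  rewrite 2![_ ^ (size s).+1]expnS -!mulnA [_.-1 * _]mulnC [M * _]mulnCA.
  apply: leq_trans (leq_mul (leqnn _) Hh) _.
  by rewrite mulnCA [X in _ <= X]mulnC leq_mul2l IHs orbT.
have [s szs Ws] := greedy (2 * M * E); have [h0 _] := card_gt0P H_gt0.
exists (fun c => nth h0 s c) => i Pi.
have -> : #|[set c : 'I_(2 * M * E) | good (nth h0 s c) i]| = count (good^~ i) s.
  rewrite -sum1_count (big_nth h0) szs big_mkord sum1dep_card.
  by apply: eq_card => c; rewrite !inE.
(* Fewer than [L] good members for [i] would make the weight exceed 2^(2ME - L), whereas by [bern]
   below it is at most 2^(2ME - E) |I|. *)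
rewrite leqNgt; apply/negP=> lt_cnt.
have Wi : 2 ^ count (fun h => ~~ good h i) s <= W s.
  by rewrite /W (bigD1 i) //= leq_addr.
have cnt : count (good^~ i) s + count (fun h => ~~ good h i) s = 2 * M * E.
  by rewrite -szs; apply: count_predC.
have M2 : (2 * M).-1.+1 = 2 * M by lia.
have bern : 2 ^ E * (2 * M).-1 ^ (2 * M * E) <= (2 * M) ^ (2 * M * E).
  rewrite !(expnM _ (2 * M)) -expnMn.
  have [->|E_gt0] := posnP E; rewrite ?expn0 // leq_exp2r //.
  by have := @double_exp_pred (2 * M).-1; rewrite M2; apply; lia.
have: 2 * (2 * M) ^ (2 * M * E) <= (2 * M) ^ (2 * M * E).
  apply: leq_trans bern; rewrite mulnC -[_ * 2](mulnC 2) expnMn mulnA -expnS.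
  apply: leq_trans (_ : 2 ^ L * W s * M ^ (2 * M * E) <= _).
    rewrite leq_mul2r; apply/orP; right; apply: leq_trans (leq_mul (leqnn _) Wi).
    by rewrite -expnD leq_exp2l // -cnt; lia.
  rewrite -mulnA [W s * _]mulnC; apply: leq_trans (leq_mul (leqnn _) Ws) _.
  by rewrite mulnCA mulnC [2 ^ L * _]mulnC leq_mul2r large orbT.
have: 0 < (2 * M) ^ (2 * M * E) by rewrite expn_gt0 muln_gt0 M_gt0.
by case: (_ ^ _) => // m _; lia.
Qed.

Lemma exp_ratio_bound N r d : 0 < N -> d <= N * r -> N.+1 ^ d <= 3 ^ r * N ^ d.
Proof.
move=> N_gt0 le_d; rewrite -(@leq_pmul2r (N ^ (N * r - d))) ?expn_gt0 ?N_gt0 //.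
rewrite -mulnA -expnD subnKC // expnM -expnMn.
apply: leq_trans (_ : N.+1 ^ (N * r) <= _).
  rewrite -{2}(subnKC le_d) expnD leq_mul2l; apply/orP; right.
  by case: (_ - _) => // e; rewrite leq_exp2r.
rewrite expnM; case: r {le_d} => // r; rewrite leq_exp2r //.
exact: succ_exp_bound.
Qed.

(** The preimage of [ord0] under a uniform [h] contains each point independently with probability
    1/(N + 1). It separates with probability (N + 1)^(-|Q|) (1 - 1/(N + 1))^|D|, and the last factor
    is at least 3^(-r). *)
Lemma separating_density (T : finType) (N q r : nat) (Q D : {set T}) :
    0 < N -> [disjoint Q & D] -> #|Q| <= q -> #|D| <= N * r ->
  #|{ffun T -> 'I_N.+1}| <= 3 ^ r * N.+1 ^ q *
    #|[set h : {ffun T -> 'I_N.+1} |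
        (Q \subset h @^-1: [set ord0]) && [disjoint h @^-1: [set ord0] & D]]|.
Proof.
move=> N_gt0 dQD leQ leD; rewrite card_ffun card_ord.
pose F z : {set 'I_N.+1} :=
  if z \in Q then [set ord0] else if z \in D then [set~ ord0] else setT.
have -> : #|[set h : {ffun T -> 'I_N.+1} |
        (Q \subset h @^-1: [set ord0]) && [disjoint h @^-1: [set ord0] & D]]|
    = \prod_z #|F z|.
  rewrite -cardsXn; apply: eq_card => h; rewrite inE in_setXn /F.
  apply/andP/forallP => [[/subsetP Q0 D'0] z | Fh].
    case: ifP => [/Q0|_]; rewrite ?inE //.
    case: ifP => [Dz|_]; rewrite ?inE //.
    by apply: contraTneq D'0 => h0; apply/pred0Pn; exists z; rewrite !inE h0 eqxx.
  split; first by apply/subsetP=> z Qz; have := Fh z; rewrite Qz !inE.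
  rewrite disjoint_sym disjoint_subset; apply/subsetP=> z Dz; have := Fh z.
  by rewrite (disjointFl dQD Dz) Dz !inE.
have prod_if (A : {set T}) a : \prod_z (if z \in A then a else 1) = a ^ #|A|.
  by rewrite -big_mkcond prod_nat_const.
have prodF : \prod_z #|F z| * N.+1 ^ #|Q| * N.+1 ^ #|D| = N.+1 ^ #|T| * N ^ #|D|.
  rewrite -!prod_if -[N.+1 ^ #|T|]prod_nat_const -!big_split /=.
  apply: eq_bigr => z _; rewrite /F.
  have [Qz|Q'z] := boolP (z \in Q).
    by rewrite (disjointFr dQD Qz) cards1; lia.
  by case: ifP => _; rewrite ?cardsC1 ?cardsT card_ord; lia.
rewrite -(@leq_pmul2r (N ^ #|D|)) ?expn_gt0 ?N_gt0 // -prodF.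
apply: leq_trans (leq_mul (leqnn _) (exp_ratio_bound N_gt0 leD)) _.
have : N.+1 ^ #|Q| <= N.+1 ^ q by rewrite leq_exp2l.
move: (\prod_z _) (3 ^ r) (N ^ _) (N.+1 ^ _) (N.+1 ^ _) => f x y b a le_ab.
rewrite (_ : f * a * _ = a * (f * x * y)); last by lia.
by rewrite (_ : x * b * f * y = b * (f * x * y)) ?leq_mul //; lia.
Qed.

Lemma card_small_sets (T : finType) q :
  #|[set S : {set T} | #|S| < q.+1]|
    = #|[set S : {set T} | #|S| < q]| + 'C(#|T|, q).
Proof.
rewrite -card_draws -cardsUI [X in _ = _ + X]eq_card0 ?addn0 => [|S].
  by apply: eq_card => S; rewrite !inE ltnS leq_eqVlt orbC.
by rewrite !inE; case: ltngtP.
Qed.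

(** Pays for the union bound in [separating_family]. At [t = 1] it reads 80 <= 81 for [q = 4] and
    fails for [q = 3], hence the case split there. *)
Lemma linear_lt_exp q t : 3 < q -> 0 < t -> 4 * q * (2 * t + 3) <= (t + 2) ^ q.
Proof.
move=> q_gt3 t_gt0; rewrite -(subnKC q_gt3); elim: (q - 4) => [|d IHd].
  by rewrite addn0 -[4]/(2 + 2) expnD -!mulnn; nia.
rewrite addnS expnSr; apply: leq_trans (leq_mul IHd (leqnn _)); nia.
Qed.

(* Up to [q = 3] the sets with fewer than [q] elements do, each taken [L] times;
   above, a random family in which each set contains every element with
   probability [1 / (N + 1)]. *)
Lemma separating_family (T : finType) (N q t : nat) :
    0 < N -> 0 < q -> (3 < q -> 0 < t) -> #|T| = (2 * (N * q)).+1 * t.+1 ->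
  exists (C : finType) (Z : C -> {set T}),
    #|C| <= ((N + 1) * (t + 2) * 3) ^ q /\
    forall Q D : {set T}, [disjoint Q & D] -> #|Q| < q -> #|D| <= N * q ->
      2 * (N * q) < #|[set c | (Q \subset Z c) && [disjoint Z c & D]]|.
Proof.
move=> N_gt0 q_gt0 q_t cardT; set L := (2 * (N * q)).+1.
have [q_gt3 | q_le3] := ltnP 3 q.
  have t_gt0 := q_t q_gt3.
  (* There are [2 ^ (2 * #|T|)] pairs of sets and [#|T| = L * t.+1], so a factor [2 ^ L] more gives
     exactly [2 ^ E]. *)
  pose H := {ffun T -> 'I_N.+1}; pose E := L * (2 * t + 3).
  pose M := 3 ^ q * N.+1 ^ q.-1.
  pose good (h : H) (QD : {set T} * {set T}) :=
    (QD.1 \subset h @^-1: [set ord0]) && [disjoint h @^-1: [set ord0] & QD.2].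
  pose P (QD : {set T} * {set T}) :=
    [&& [disjoint QD.1 & QD.2], #|QD.1| < q & #|QD.2| <= N * q].
  have M_gt0 : 0 < M by rewrite muln_gt0 !expn_gt0.
  have [|[Q D] /and3P[dQD ltQ leD]||Z HZ] := @multicover _ H P good M E L M_gt0.
  - by rewrite card_ffun card_ord expn_gt0.
  - by apply: separating_density; rewrite // -ltnS prednK.
  - rewrite card_prod -!cardsT -powersetT card_powerset cardsT cardT -!expnD.
    by rewrite leq_exp2l // /E -/L; lia.
  exists 'I_(2 * M * E), (fun c => Z c @^-1: [set ord0]); split.
    have Nq : N.+1 ^ q = N.+1 ^ q.-1 * N.+1 by rewrite -expnSr prednK.
    rewrite card_ord addn1 [X in _ <= X]expnMn [X in _ <= X * _]expnMn Nq /M.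
    have := linear_lt_exp q_gt3 t_gt0.
    move: (3 ^ q) (N.+1 ^ _) ((t + 2) ^ q) => x y z le_z.
    rewrite (_ : 2 * (x * y) * E = x * y * (2 * E)); last by lia.
    rewrite (_ : y * N.+1 * z * x = x * y * (N.+1 * z)); last by lia.
    rewrite leq_mul2l; apply/orP; right; apply: leq_trans (leq_mul (leqnn _) le_z).
    rewrite /E /L; move: (2 * t + 3) => u.
    rewrite mulnA (_ : N.+1 * _ = 2 * (2 * (q * N.+1)) * u); last by lia.
    by rewrite leq_mul2r; apply/orP; right; lia.
  by move=> Q D dQD ltQ leD; apply: (HZ (Q, D)); rewrite /P dQD ltQ.
pose S := {X : {set T} | #|X| < q}.
exists ('I_L * S)%type, (fun c => val c.2); split; last first.
  move=> Q D dQD ltQ leD; pose s : S := Sub Q ltQ.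
  apply: leq_trans (_ : #|[set (l, s) | l in [set: 'I_L]]| <= _).
    by rewrite card_imset ?cardsT ?card_ord // => l1 l2 [].
  apply/subset_leq_card/subsetP => _ /imsetP[l _ ->].
  by rewrite inE /= subxx.
rewrite card_prod card_ord card_sig -[#|[pred _ | _]|]cardsE.
have le_L : L <= 2 * q * (N + 1) by rewrite /L; lia.
have le_T : #|T| <= 2 * q * (N + 1) * t.+1 by rewrite cardT leq_mul2r le_L orbT.
apply: leq_trans (leq_mul le_L (leqnn _)) _.
rewrite (_ : t + 2 = t.+1.+1); last by rewrite addn2.
have small0 : #|[set X : {set T} | #|X| < 0]| = 0.
  by apply: eq_card0 => X; rewrite inE.
move: le_T; rewrite addn1.
case: q q_gt0 q_le3 {q_t cardT L S le_L} => [|[|[|[|q]]]] // _ _ le_T;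
  rewrite !card_small_sets small0 ?bin0 ?bin1 ?bin2.
- by rewrite expn1; lia.
- rewrite -mulnn; apply: leq_trans (leq_mul (leqnn _) (leq_add (leqnn _) le_T)) _.
  by nia.
have le_bin : (#|T| * #|T|.-1)./2 <= 18 * (N.+1 * t.+1) * (N.+1 * t.+1).
  rewrite leq_half_double -mul2n.
  apply: leq_trans (leq_mul le_T (leq_trans (leq_pred _) le_T)) _; lia.
apply: leq_trans (leq_mul (leqnn _) (leq_add (leq_add (leqnn _) le_T) le_bin)) _.
have poly_le : 6 + 36 * t.+1 + 108 * (t.+1 * t.+1) <= 27 * t.+2 ^ 3.
  by rewrite expnS -mulnn; nia.
apply: leq_trans (_ : N.+1 ^ 3 * (6 + 36 * t.+1 + 108 * (t.+1 * t.+1)) <= _).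
  by rewrite expnS -mulnn; nia.
apply: leq_trans (leq_mul (leqnn _) poly_le) _.
by rewrite !expnMn mulnA mulnAC.
Qed.

(** * Walks, weak reachability and geodesics *)

Section Walks.
Variable G : sgraph.
Implicit Types (A : pred G) (x y z : G) (p : seq G) (L : {set G * G}).

(** Bounded length and allowed repetitions make concatenation immediate; by [WReachE] they do not
    change weak reachability. *)
Definition walk n A x y := [exists p : n.-bseq G,
  [&& path (@edge G) x p, last x p == y & all A (x :: p)]].

Lemma walkP n A x y :
  reflect (exists p, [/\ path (@edge G) x p, last x p = y, size p <= n
                        & all A (x :: p)])
          (walk n A x y).
Proof.
apply: (iffP existsP) => [[p /and3P[xp /eqP py Ap]] | [p [xp py lepn Ap]]].
  by exists p; rewrite size_bseq.
by exists (Bseq lepn); rewrite /= xp py eqxx.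
Qed.

Lemma walk_sym n A x y : walk n A x y -> walk n A y x.
Proof.
case/walkP=> p [xp <- lepn Ap]; apply/walkP; exists (rev (belast x p)).
split; last 1 first.
- by rewrite -rev_rcons -lastI all_rev.
- by rewrite rev_path (eq_path (e' := @edge G)) // => u v; rewrite edge_sym.
- by case: p {xp lepn Ap} => //= a p; rewrite rev_cons last_rcons.
- by rewrite size_rev size_belast.
Qed.

Lemma walk_cat n m A x y z :
  walk n A x y -> walk m A y z -> walk (n + m) A x z.
Proof.
case/walkP=> p [xp <- lepn Ap] /walkP[p' [yp' <- lep'm /=/andP[_ Ap']]].
apply/walkP; exists (p ++ p').
by rewrite cat_path last_cat size_cat leq_add // -cat_cons all_cat Ap xp yp'.
Qed.

Lemma walkW n m A B x y :
  n <= m -> {subset A <= B} -> walk n A x y -> walk m B x y.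
Proof.
move=> lenm sAB /walkP[p [xp py lepn Ap]]; apply/walkP; exists p.
by rewrite (leq_trans lepn lenm); split=> //; apply: sub_all Ap.
Qed.

Lemma WReachE r L x y : (x \in WReach r L y) = walk r (fun z => (x, z) \in L) x y.
Proof.
rewrite inE; apply/existsP/walkP => [[n /existsP[p]] | [p []]].
  case/andP=> /and3P[xp /eqP py _] Lp; exists p.
  by rewrite size_tuple -ltnS ltn_ord.
case/shortenP=> {}p' xp' Up' sp' <- lepr /=/andP[Lx Lp].
have lep'r : size p' < r.+1.
  by rewrite ltnS (leq_trans _ lepr) // uniq_leq_size //; case/andP: Up'.
exists (Ordinal lep'r); apply/existsP; exists (in_tuple p').
rewrite /is_path xp' eqxx Up' /= Lx.
by apply/allP=> z /sp'; apply: (allP Lp).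
Qed.

Lemma total_orderingP L : total_ordering L ->
  [/\ forall x, (x, x) \in L,
      forall x y z, (x, y) \in L -> (y, z) \in L -> (x, z) \in L
    & forall x y, ((x, y) \in L) || ((y, x) \in L)].
Proof.
case/and4P=> /forallP refl _ /forallP trans /forallP tot; split=> // [x y z|x].
  move=> xy yz; have /forallP/(_ y)/forallP/(_ z) := trans x.
  by rewrite xy yz.
exact/forallP.
Qed.

Lemma WReach_refl r L x : total_ordering L -> x \in WReach r L x.
Proof.
case/total_orderingP=> refl _ _; rewrite WReachE; apply/walkP.
by exists [::]; rewrite /= refl.
Qed.

Lemma exists_min L x p : total_ordering L ->
  exists2 m, m \in x :: p & all (fun z => (m, z) \in L) (x :: p).
Proof.
case/total_orderingP=> refl trans tot.
elim: p x => [|y p IHp] x; first by exists x; rewrite ?mem_head //= refl.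
have [m yp_m Lm] := IHp y; have /orP[xm|mx] := tot x m.
  exists x; rewrite ?mem_head //; apply/andP; split=> //.
  by apply: sub_all Lm => z; apply: trans.
by exists m; [rewrite in_cons yp_m orbT | apply/andP].
Qed.

Definition hub_walk L v x p :=
  [&& path (@edge G) v p, last v p == x & all (fun z => (v, z) \in L) (v :: p)].

(** A fixed shortest witness that [v] is a hub of [x]; its length and sign give the label of the
    hub. The default [[::]] is taken only when there is no witness. *)
Definition hubpath r L x v : seq G :=
  if [pick p : r.-bseq G | hub_walk L v x p
        && [forall p' : r.-bseq G, hub_walk L v x p' ==> (size p <= size p')]]
  is Some p then p else [::].

Lemma hubpathP r L x v : v \in WReach r L x ->
  [/\ hub_walk L v x (hubpath r L x v), size (hubpath r L x v) <= r
    & forall p, hub_walk L v x p -> size (hubpath r L x v) <= size p].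
Proof.
rewrite WReachE => /walkP[p0 [vp0 p0x lep0r Lp0]].
have w0 : hub_walk L v x (Bseq lep0r) by rewrite /hub_walk /= vp0 p0x eqxx.
rewrite /hubpath; case: pickP => [p /andP[wp /forallP min_p] | nop].
  split=> [||p' wp']; rewrite ?size_bseq //.
  have [lep'r|/ltnW] := leqP (size p') r.
    by have /implyP := min_p (Bseq lep'r); apply.
  by apply: leq_trans; apply: size_bseq.
have [p wp min_p] :
    {p : r.-bseq G | hub_walk L v x p
       & forall p' : r.-bseq G, hub_walk L v x p' -> size p <= size p'}.
  case: (@arg_minnP _ (Bseq lep0r) (fun p : r.-bseq G => hub_walk L v x p)
            (fun p : r.-bseq G => size p) w0) => p wp min_p; by exists p.
by have /andP[] := nop p; rewrite wp; split=> //; apply/forallP=> p'; apply/implyP/min_p.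
Qed.

Lemma path_neg_cat (sigma : signature G) x p p' :
  path_neg sigma x (p ++ p') = path_neg sigma x p (+) path_neg sigma (last x p) p'.
Proof. by rewrite /path_neg pairmap_cat big_cat. Qed.

Lemma hat_edge_dist (sigma : signature G) k x y p :
  hat_edge sigma k x y -> path (@edge G) x p -> last x p = y -> k <= size p.
Proof.
case/andP=> /andP[_ /forallP near] _; case/shortenP=> p' xp' Up' sp' p'y.
apply: leq_trans (_ : size p' <= _); last first.
  by apply: uniq_leq_size => //; case/andP: Up'.
rewrite leqNgt; apply/negP=> lt_p'k.
have /negP[] := near (Ordinal lt_p'k); apply/existsP.
by exists (in_tuple p'); rewrite /is_path xp' p'y eqxx.
Qed.

Lemma hat_edge_walk (sigma : signature G) k x y n A :
  hat_edge sigma k x y -> walk n A x y -> k <= n.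
Proof.
by move=> xy /walkP[p [xp py lepn _]]; apply: leq_trans (hat_edge_dist xy xp py) lepn.
Qed.

(** A repeated vertex could be cut out, giving a walk shorter than the distance [k]. *)
Lemma hat_edge_geodesic_neg (sigma : signature G) k x y p :
  hat_edge sigma k x y -> path (@edge G) x p -> last x p = y -> size p <= k ->
  path_neg sigma x p.
Proof.
move=> xy xp py lepk.
have Up : uniq (x :: p).
  move: (xp) (py); case/shortenP=> p' xp' Up' sp' p'y.
  apply: leq_size_uniq Up' _ _ => [z|]; first by rewrite !inE => /orP[->|/sp'->]; rewrite ?orbT.
  by rewrite /= ltnS (leq_trans lepk) // (hat_edge_dist xy xp').
have szp : size p == k by rewrite eqn_leq lepk (hat_edge_dist xy xp py).
have /andP[_ /forallP/(_ (Tuple szp))/implyP] := xy; apply.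
by rewrite /is_path /= xp py eqxx -cons_uniq.
Qed.

Lemma hat_edge_signs (sigma : signature G) k x y v p p' :
  hat_edge sigma k x y -> path (@edge G) v p -> last v p = x ->
  path (@edge G) v p' -> last v p' = y -> size p + size p' <= k ->
  path_neg sigma v p (+) path_neg sigma v p'.
Proof.
move=> xy vp px vp' p'y lek.
have lastr : last x (rev (belast v p)) = v.
  by rewrite -px; case: p {vp px lek} => //= a p; rewrite rev_cons last_rcons.
have := @hat_edge_geodesic_neg sigma k x y (rev (belast v p) ++ p') xy.
rewrite path_neg_cat lastr -{3}px path_neg_rev; apply.
- rewrite cat_path lastr vp' andbT -px rev_path.
  by rewrite (eq_path (e' := @edge G)) // => u w; rewrite edge_sym.
- by rewrite last_cat lastr.
- by rewrite size_cat size_rev size_belast.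
Qed.

End Walks.

(** * Hubs across an edge of the hat graph *)

Lemma half_complement a b k : a + b <= k -> k./2 < a -> b <= k./2.
Proof. by have := odd_double_half k; lia. Qed.

Section Coloring.
Variables (G : sgraph) (sigma : signature G) (k : nat) (L1 L2 : {set G * G}).
Hypotheses (ord1 : total_ordering L1) (ord2 : total_ordering L2).
Let t := k./2.
Implicit Types (u v w x y z : G) (p : seq G).

Let reach1 v x := v \in WReach t L1 x.
Let reach2 w x := w \in WReach k L2 x.
Let above w : pred G := fun z => (w, z) \in L2.
Let hp x v := hubpath t L1 x v.
Let wd x v := size (hp x v).
Let sgn x v := path_neg sigma v (hp x v).

Definition hub_arc u v := (u != v) && [exists w, reach2 w u && reach1 v w].

(* [y] and [x] are adjacent in the hat graph and joined by a geodesic on which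
   [w] is the [L2]-minimum and [v] the [L1]-minimum between [x] and [w]; in
   particular [y] sees [w], and [w] sees [v]. *)
Definition danger y x v := [&& hat_edge sigma k x y, reach1 v x
  & [exists w, [&& reach1 v w, walk (k - wd x v) (above w) w y
                 & walk (k - wd x v) (above w) v y]]].

Let t2_le_k : t + t <= k.
Proof. by rewrite addnn -[X in _ <= X]odd_double_half leq_addl. Qed.

Let wd_le x v : reach1 v x -> wd x v <= t.
Proof. by case/hubpathP. Qed.

Let above_trans w w' : (w, w') \in L2 -> {subset above w' <= above w}.
Proof.
have [_ trans _] := total_orderingP ord2.
by move=> ww' z; apply: trans ww'.
Qed.

(** The [L1]-minimum [v] of [p1] cuts it into [q1] and [q2], which make [v] a hub of both [x] and
    [w]. As [wd x v] is at most the length of [q1], the rest of the walk fits into [k - wd x v]. *)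
Lemma danger_intro x y w p1 p2 :
  hat_edge sigma k x y ->
  path (@edge G) x p1 -> last x p1 = w -> all (above w) (x :: p1) ->
  path (@edge G) w p2 -> last w p2 = y -> all (above w) p2 ->
  size p1 + size p2 <= k -> size p1 <= t -> exists v, danger y x v.
Proof.
move=> xy xp1 p1w Ap1 wp2 p2y Ap2 lek let1.
have [[refl1 _ _] [refl2 _ _]] := (total_orderingP ord1, total_orderingP ord2).
have [v xp1v Lv] := exists_min x p1 ord1; exists v.
move: xp1 p1w Ap1 lek let1 Lv; case/splitPl: xp1v => q1 q2 q1v.
rewrite cat_path last_cat q1v size_cat => /andP[xq1 vq2] q2w Aq lek let1 Lq.
have Lq1 : all (fun z => (v, z) \in L1) (x :: q1).
  by move: Lq; rewrite -cat_cons all_cat => /andP[].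
have Lq2 : all (fun z => (v, z) \in L1) (v :: q2).
  rewrite /= refl1.
  by move: Lq; rewrite -cat_cons all_cat => /andP[].
have Aq2 : all (above w) (v :: q2).
  rewrite [all _ _]/= (allP Aq v) /=; last by rewrite -cat_cons mem_cat -q1v mem_last.
  by move: Aq; rewrite -cat_cons all_cat => /andP[].
have vx : reach1 v x.
  rewrite /reach1 WReachE; apply/walk_sym/walkP; exists q1; split=> //.
  by apply: leq_trans let1; apply: leq_addr.
have vy : walk (size q2 + size p2) (above w) v y.
  apply: (@walk_cat _ _ _ _ v w y); first by apply/walkP; exists q2.
  by apply/walkP; exists p2; rewrite /= Ap2 /above refl2.
have le_wd : wd x v <= size q1.
  have := walk_sym (n := size q1) (A := fun z => (v, z) \in L1) (x := x) (y := v).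
  case/(_ _)/walkP=> [|p [vp px lep Lp]]; first by apply/walkP; exists q1.
  apply: leq_trans lep; have [_ _] := hubpathP vx; apply.
  by apply/and3P; rewrite px.
have [le_p2 le_q2] : size p2 <= k - wd x v /\ size q2 + size p2 <= k - wd x v.
  move: lek le_wd; move: (wd x v) (size q1) (size q2) (size p2) => a b c d.
  by clear; lia.
rewrite /danger xy vx; apply/existsP; exists w; apply/and3P; split.
- rewrite /reach1 WReachE; apply/walkP; exists q2; split=> //.
  by apply: leq_trans let1; apply: leq_addl.
- apply/walkP; exists p2; split; rewrite ?wp2 ?p2y ?le_p2 //.
  by rewrite /= Ap2 /above refl2.
- exact: walkW le_q2 _ vy.
Qed.

Lemma danger_exists x y :
  hat_edge sigma k x y -> exists v, danger y x v \/ danger x y v.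
Proof.
move=> xy; have /andP[/andP[/existsP[p /and3P[xp /eqP py _]] _] _] := xy.
have [w xpw Aw] := exists_min x p ord2.
have szp : size p = k by rewrite size_tuple.
move: xp py Aw szp; case/splitPl: xpw => p1 p2 p1w.
rewrite cat_path last_cat p1w size_cat => /andP[xp1 wp2] p2y Aw szp.
have Aw1 : all (above w) (x :: p1).
  by move: Aw; rewrite -cat_cons all_cat => /andP[].
have Aw2 : all (above w) p2.
  by move: Aw; rewrite -cat_cons all_cat => /andP[].
(* One of the two pieces has length at most [k./2]; if it is the second, the geodesic is read
   backwards. *)
have [le1|lt1] := leqP (size p1) t.
  have [||v] := danger_intro xy xp1 p1w Aw1 wp2 p2y Aw2; rewrite ?szp //.
  by exists v; left.
have [refl2 _ _] := total_orderingP ord2.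
have /walk_sym/walkP[p2' [yp2' p2'w lep2' Ap2']] : walk (size p2) (above w) w y.
  by apply/walkP; exists p2; rewrite /= Aw2 /above refl2.
have /walk_sym/walkP[p1' [wp1' p1'x lep1' /=/andP[_ Ap1']]] :
    walk (size p1) (above w) x w by apply/walkP; exists p1.
have [|||v] := danger_intro _ yp2' p2'w Ap2' wp1' p1'x Ap1'.
- by rewrite hat_edge_sym.
- by rewrite -szp addnC leq_add.
- by apply: leq_trans lep2' _; apply: half_complement lt1; rewrite szp.
by exists v; right.
Qed.

(** Let [r] be the [L2]-minimum of the hub path from [u] to [y]. If [w] precedes [r], the walk from
    [w] through [y] to [u] shows that [u] sees [v]; otherwise the walk from [r] through [y] to [v]
    shows that [v] sees [u]. Equal distances keep both walks within [k]. *)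
Lemma danger_arc y x u v :
  danger y x v -> reach1 u y -> wd y u = wd x v -> u != v ->
  hub_arc u v || hub_arc v u.
Proof.
case/and3P=> xy vx /existsP[w /and3P[vw wy vy]] uy eq_wd u'v.
have [refl2 trans2 tot2] := total_orderingP ord2.
have le_wd : wd x v <= k.
  by apply: leq_trans (wd_le vx) _; apply: leq_trans t2_le_k; apply: leq_addr.
have [/and3P[uR /eqP Ry LR] leR _] := hubpathP uy.
have [r uRr Ar] := exists_min u (hp y u) ord2.
have [wr|rw] := boolP ((w, r) \in L2).
  apply/orP; left; rewrite /hub_arc u'v; apply/existsP; exists w.
  rewrite vw andbT /reach2 WReachE -(subnK le_wd).
  apply: walk_cat wy _; apply/walk_sym/walkP; exists (hp y u); split=> //.
    by rewrite -eq_wd.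
  by apply: sub_all Ar => z; apply: above_trans.
have {}rw : (r, w) \in L2 by have := tot2 w r; rewrite (negbTE rw).
apply/orP; right; rewrite /hub_arc eq_sym u'v; apply/existsP; exists r.
move: uR Ry LR leR Ar eq_wd; rewrite /wd -/(hp y u).
case/splitPl: uRr => p1 p2 p1r.
rewrite cat_path last_cat p1r size_cat => /andP[up1 rp2] p2y LR leR Ar eq_wd.
apply/andP; split.
  rewrite /reach2 WReachE -(subnKC le_wd).
  apply: (@walk_cat _ _ _ _ r y v).
    apply/walkP; exists p2; split=> //; first by rewrite /wd -eq_wd leq_addl.
    by rewrite /= refl2; move: Ar; rewrite -cat_cons all_cat => /andP[].
  by apply: walk_sym; apply: walkW vy => // z; apply: above_trans.
rewrite /reach1 WReachE; apply/walkP; exists p1; split=> //.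
  by apply: leq_trans leR; apply: leq_addr.
by move: LR; rewrite -cat_cons all_cat => /andP[].
Qed.

Lemma danger_sign y x v p : danger y x v ->
  path (@edge G) v p -> last v p = y -> size p <= k - wd x v ->
  sgn x v (+) path_neg sigma v p.
Proof.
case/and3P=> xy vx _ vp py lep.
have [/and3P[vR /eqP Rx _] leR _] := hubpathP vx.
apply: (hat_edge_signs xy vR Rx vp py); rewrite -/(hp x v) -/(wd x v).
have le_k : wd x v <= k.
  by apply: leq_trans (wd_le vx) (leq_trans (leq_addr t t) t2_le_k).
by apply: leq_trans (leq_add (leqnn _) lep) _; rewrite subnKC.
Qed.

(** If the distances differed, the shorter hub path and the walk from [v] to [y] of the other danger
    would join the nearer neighbour to [y] in fewer than [k] steps. *)
Lemma danger_wd y x x' v : danger y x v -> danger y x' v -> wd x v = wd x' v.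
Proof.
suff le_wd a b : danger y a v -> danger y b v -> wd b v <= wd a v.
  by move=> dx dx'; apply/eqP; rewrite eqn_leq !le_wd.
case/and3P=> ay va _ /and3P[_ vb /existsP[w /and3P[_ _ vy]]].
have [/and3P[vR /eqP Ra _] _ _] := hubpathP va.
have vaW : walk (wd a v) predT v a by apply/walkP; exists (hp a v); rewrite all_predT.
have vyW : walk (k - wd b v) predT v y by apply: walkW vy.
have := hat_edge_walk ay (walk_cat (walk_sym vaW) vyW).
have le_k : wd b v <= k.
  by apply: leq_trans (wd_le vb) (leq_trans (leq_addr t t) t2_le_k).
move: le_k; move: (wd a v) (wd b v) => c d; move: k; clear; lia.
Qed.

Lemma danger_sgn y x x' v : danger y x v -> danger y x' v -> sgn x v = sgn x' v.
Proof.
move=> dx dx'; have := danger_wd dx dx'.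
have /and3P[_ _ /existsP[w /and3P[_ _ /walkP[p [vp py lep _]]]]] := dx.
move=> eq_wd; have := danger_sign dx vp py lep.
have := danger_sign dx' vp py; rewrite -eq_wd => /(_ lep).
by case: (sgn x v); case: (sgn x' v); case: path_neg.
Qed.

(** The walk from [x] through [v] to [y] has length at most [t + t <= k], so it is a negative
    geodesic with [v] in the middle. *)
Lemma danger_shared_hub y x v :
  danger y x v -> reach1 v y -> wd y v = wd x v ->
  wd x v = t /\ sgn y v != sgn x v.
Proof.
move=> dx vy eq_wd; have /and3P[xy vx _] := dx.
have [/and3P[vR /eqP Rx _] _ _] := hubpathP vx.
have [/and3P[vR' /eqP Ry _] _ _] := hubpathP vy.
have vxW : walk (wd x v) predT v x by apply/walkP; exists (hp x v); rewrite all_predT.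
have vyW : walk (wd y v) predT v y by apply/walkP; exists (hp y v); rewrite all_predT.
have := hat_edge_walk xy (walk_cat (walk_sym vxW) vyW); rewrite eq_wd => le_k.
have := wd_le vx => le_t; have {le_k} eq_t : wd x v = t.
  move: le_k le_t t2_le_k; move: (wd x v) t => a b; clear; lia.
split=> //.
have := danger_sign dx vR' Ry; rewrite -/(hp y v) -/(wd y v) -/(sgn y v) eq_wd.
rewrite leq_subRL ?eq_t ?(leq_trans (leq_addr t t)) // => /(_ t2_le_k).
by case: (sgn x v); case: (sgn y v).
Qed.

Lemma wd_gt0 x v : reach1 v x -> v != x -> 0 < wd x v.
Proof.
case/hubpathP=> /and3P[_ /eqP + _] _ _; rewrite -/(hp x v) /wd.
by case: (hp x v) => //= ->; rewrite eqxx.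
Qed.

(* Signs matter only for hubs at distance exactly [k./2], which keeps the number
   of labels down to [k./2 + 1]. *)
Definition hub_label x v : 'I_t.+1 := inord ((wd x v).-1 + ((wd x v == t) && sgn x v)).

(** Distances below [t] get labels up to [t - 2], and distance [t] gets [t - 1] or [t] by its sign.
    Distance 0, excluded here, would be confused with distance 1. *)
Lemma hub_label_inj x v y u :
    reach1 v x -> v != x -> reach1 u y -> u != y ->
    hub_label x v = hub_label y u ->
  wd x v = wd y u /\ (wd x v = t -> sgn x v = sgn y u).
Proof.
have lt_lab z w : reach1 w z -> w != z ->
    (wd z w).-1 + ((wd z w == t) && sgn z w) < t.+1.
  move=> wz w'z; move: (wd_le wz) (wd_gt0 wz w'z); move: (wd z w) (sgn z w) t => a s c.
  by clear=> ? ?; case: s; case: eqVneq => /=; lia.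
move=> vx v'x uy u'y /(congr1 (@nat_of_ord _)).
rewrite /hub_label !inordK ?lt_lab //.
move: (wd_le vx) (wd_le uy) (wd_gt0 vx v'x) (wd_gt0 uy u'y).
move: (wd x v) (wd y u) (sgn x v) (sgn y u) t => a b s s' c; clear=> at_ bt a0 b0.
by case: s; case: s'; case: (eqVneq a c); case: (eqVneq b c) => /= ? ?; split; lia.
Qed.

(** * Colouring by separating sets *)

Variables (N q : nat).
Hypotheses (card1 : forall x, #|WReach t L1 x| <= q).
Hypotheses (card2 : forall x, #|WReach k L2 x| <= N).

Let hubs_seen y := \bigcup_(w in WReach k L2 y) WReach t L1 w.

Let card_hubs_seen y : #|hubs_seen y| <= N * q.
Proof.
apply: leq_trans (_ : \sum_(w in WReach k L2 y) #|WReach t L1 w| <= _).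
  rewrite /hubs_seen; elim/big_rec2: _ => [|w m B _ leB]; first by rewrite cards0.
  by apply: leq_trans (leq_card_setU _ _) _; rewrite leq_add2l.
apply: leq_trans (_ : \sum_(w in WReach k L2 y) q <= _); first exact: leq_sum.
by rewrite sum_nat_const leq_mul2r card2 orbT.
Qed.

Lemma hub_arc_outdegree u : #|[set v | hub_arc u v]| <= N * q.
Proof.
apply: leq_trans (card_hubs_seen u); apply/subset_leq_card/subsetP=> v.
rewrite inE => /andP[_ /existsP[w /andP[wu vw]]].
by apply/bigcupP; exists w.
Qed.

Lemma hat_colorable : 0 < N -> 0 < q -> (3 < q -> 0 < t) ->
  exists2 n, n <= ((N + 1) * (t + 2) * 3) ^ q & colorable (hat_graph sigma k) n.
Proof.
move=> N_gt0 q_gt0 q_t.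
have arc_irr : irreflexive hub_arc by move=> u; rewrite /hub_arc eqxx.
have [|a _ propa] := arc_list_coloring (lst := fun=> [set: 'I_(2 * (N * q)).+1])
                        arc_irr hub_arc_outdegree.
  by move=> u; rewrite cardsT card_ord.
pose T : finType := ('I_(2 * (N * q)).+1 * 'I_t.+1)%type.
pose node x v : T := (a v, hub_label x v).
pose Q y := [set node y u | u in WReach t L1 y :\ y].
pose D y := [set nd | [exists x, exists v,
  [&& danger y x v, v != x & nd == node x v]]].
have cardT : #|T| = (2 * (N * q)).+1 * t.+1.
  by rewrite card_prod !card_ord.
have [C [Z [cardC sepZ]]] := separating_family N_gt0 q_gt0 q_t cardT.
have refl_hub z : reach1 z z /\ wd z z = 0.
  have zz : hub_walk L1 z z [::].
    by have [refl1 _ _] := total_orderingP ord1; rewrite /hub_walk /= eqxx refl1.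
  have zr : reach1 z z by apply: WReach_refl.
  split=> //; apply/eqP; rewrite -leqn0.
  by have [_ _ /(_ _ zz)] := hubpathP zr.
have disjQD y : [disjoint Q y & D y].
  apply/pred0P=> nd /=; apply/negP=> /andP[/imsetP[u]].
  rewrite in_setD1 => /andP[u'y uy] ->; rewrite inE => /existsP[x /existsP[v /and3P[dx v'x /eqP]]].
  have /and3P[xy vx _] := dx; case=> eq_a /(hub_label_inj uy u'y vx v'x)[eq_wd eq_sgn].
  (* A shared hub has opposite signs at distance [t], against equal labels; distinct hubs are joined
     by an arc, against equal colours. *)
  have [eq_uv|u'v] := eqVneq u v.
    rewrite -eq_uv in dx eq_wd eq_sgn.
    have [wd_t] := danger_shared_hub dx uy eq_wd.
    by rewrite eq_sgn ?eqxx // eq_wd.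
  by case/orP: (danger_arc dx uy eq_wd u'v) => /propa; rewrite eq_a eqxx.
have cardQ y : #|Q y| < q.
  apply: leq_ltn_trans (leq_imset_card _ _) _; apply: leq_trans (card1 y).
  by have [+ _] := refl_hub y; rewrite /reach1 [X in _ < X](cardsD1 y) => ->.
have cardD y : #|D y| <= N * q.
  (* Any neighbour [x] with danger [v] yields the same pair, so one choice per hub seen by [y]
     covers [D y]. *)
  pose g v := node (odflt y [pick x | danger y x v]) v.
  apply: leq_trans (card_hubs_seen y); apply: leq_trans (leq_imset_card g _).
  apply/subset_leq_card/subsetP=> nd; rewrite inE.
  case/existsP=> x /existsP[v /and3P[dx _ /eqP->]]; apply/imsetP; exists v.
    have /and3P[_ _ /existsP[w /and3P[vw wy _]]] := dx.
    apply/bigcupP; exists w; rewrite // WReachE.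
    by apply: walkW wy; rewrite ?leq_subr.
  rewrite /g; case: pickP => [x' dx' | /(_ x)]; last by rewrite dx.
  by rewrite /node /hub_label (danger_wd dx dx') (danger_sgn dx dx').
have [|c lstc propc] := arc_list_coloring
  (lst := fun y => [set c | (Q y \subset Z c) && [disjoint Z c & D y]])
  arc_irr hub_arc_outdegree.
  by move=> y; apply: sepZ.
have no_edge y x v : danger y x v -> c x <> c y.
  move=> dx eq_c; have /and3P[xy vx _] := dx.
  (* If [v = x], then [x] and [y] are their own hubs at distance 0, so [danger_arc] gives an arc
     between them. *)
  have [eq_vx|v'x] := eqVneq v x.
    have y'x : y != x.
      by apply: contraTneq xy => ->; rewrite hat_edge_irr.
    rewrite eq_vx in dx; have [yy wdy] := refl_hub y; have [_ wdx] := refl_hub x.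
    have /orP[] := danger_arc dx yy (etrans wdy (esym wdx)) y'x.
      by move/propc; rewrite eq_c eqxx.
    by move/propc; rewrite eq_c eqxx.
  have := lstc x; have := lstc y; rewrite 2!inE -eq_c => /andP[_ disjD] /andP[subQ _].
  have Qnd : node x v \in Z (c x).
    by apply: (subsetP subQ); apply: imset_f; rewrite in_setD1 v'x.
  have /negP[] : node x v \notin D y by rewrite (disjointFr disjD Qnd).
  by rewrite inE; apply/existsP; exists x; apply/existsP; exists v; rewrite dx v'x /=.
exists #|C| => //; apply/existsP; exists [ffun x => enum_rank (c x)].
apply/forallP=> x; apply/forallP=> y; apply/implyP=> xy; rewrite !ffunE.
apply/eqP=> /enum_rank_inj eq_c.
have [v [dv|dv]] := danger_exists xy; first exact: no_edge dv eq_c.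
exact: no_edge dv (esym eq_c).
Qed.

End Coloring.

(** * The bound from two optimal orderings *)

Lemma chi_leq (G : sgraph) n : colorable G n -> chi G <= n.
Proof. by rewrite /chi; case: ex_minnP => m _ min_m /min_m. Qed.

Lemma wcol_ordering (G : sgraph) r : exists2 L : {set G * G},
  total_ordering L & wcol G r = \max_(v : G) #|WReach r L v|.
Proof.
rewrite /wcol; case: ex_minnP => m /existsP[L /andP[ordL /eqP <-]] _.
by exists L.
Qed.

Lemma card_WReach0 (G : sgraph) (L : {set G * G}) (y : G) : #|WReach 0 L y| <= 1.
Proof.
rewrite -(cards1 y); apply/subset_leq_card/subsetP=> x.
rewrite WReachE => /walkP[p [_ <- lep _]]; rewrite inE.
by case: p lep.
Qed.

Theorem theorem8 (G : sgraph) (sigma : signature G) (k : nat) (hk : 0 < k) :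
  chi (hat_graph sigma k) <=
    ((wcol G k + 1) * (k./2 + 2) * 3) ^ wcol G k./2.
Proof.
(* In the empty graph both weak colouring numbers are 0, against the positivity required by
   [hat_colorable]. *)
have [cardG | /card_gt0P[x0 _]] := posnP #|G|.
  apply: leq_trans (_ : #|G| <= _); last by rewrite cardG.
  apply: chi_leq; apply/existsP; exists [ffun x => enum_rank x].
  by apply/forallP=> x; have := card0_eq cardG x.
have [L1 ord1 q_def] := wcol_ordering G k./2.
have [L2 ord2 N_def] := wcol_ordering G k.
have card1 x : #|WReach k./2 L1 x| <= wcol G k./2.
  by rewrite q_def (leq_bigmax (F := fun v => #|WReach k./2 L1 v|)).
have card2 x : #|WReach k L2 x| <= wcol G k.
  by rewrite N_def (leq_bigmax (F := fun v => #|WReach k L2 v|)).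
have pos (L : {set G * G}) r m : total_ordering L -> #|WReach r L x0| <= m -> 0 < m.
  move=> ordL; apply: leq_trans; apply/card_gt0P; exists x0.
  exact: WReach_refl.
have [||| n le_n col_n] := hat_colorable sigma ord1 ord2 card1 card2.
- exact: pos ord2 (card2 x0).
- exact: pos ord1 (card1 x0).
(* For [k./2 = 0] a vertex reaches only itself, so the exponent is at most 1. *)
- rewrite q_def; case: k./2 => // gt3; suff: 3 < 1 by [].
  by apply: leq_trans gt3 _; apply/bigmax_leqP=> v _; apply: card_WReach0.
by apply: leq_trans le_n; apply: chi_leq.
Qed.
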